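(* Let $(V,\leq)$ be a topological vector lattice, let $\mathcal{K}_0\subset V$ be a convex cone, let $U\subset V$ be an ideal which is dense in $V$, and let $\tau$ be a topology on $U$ such that $(U,\leq)$ equipped with $\tau$ is a locally convex topological vector lattice. Let $\mathcal{C}:=(\mathcal{K}_0-V_+)\cap U$. Suppose that $(U,\tau)$ has the Kreps-Yan property. Then the following statements are equivalent: (i) $\mathcal{K}_0$ satisfies NFL$_\tau$, that is, $\overline{\mathcal{C}}^{\tau}\cap U_+=\{0\}$. (ii) There exists a strictly separating functional $x'\in U'_{++}$ for $\mathcal{C}$.
   Context: A topological vector lattice is a real vector lattice which is a Hausdorff topological vector space having a zero neighborhood basis of solid sets ($A$ is solid if $x\in A$, $|y|\leq|x|$ imply $y\in A$). An ideal is a solid linear subspace. $V_+=\{x\in V:x\geq0\}$, $U_+=V_+\cap U$. A convex cone is a nonempty set closed under $ax+by$ for $a,b\geq0$ (in particular it contains $0$). $\overline{\mathcal{C}}^{\tau}$ is the closure of $\mathcal{C}$ in $(U,\tau)$. $U'$ is the space of $\tau$-continuous linear functionals on $U$; $U'_+$ is the set of $x'\in U'$ with $x'(U_+)\subset[0,\infty)$; $U'_{++}$ is the set of $x'\in U'_+$ with $x'(x)>0$ for all $x\in U_+\setminus\{0\}$. A functional $x'\in U'_+$ is separating for a set $\mathcal{D}\subset U$ if $x'(y)\leq0$ for all $y\in\mathcal{D}$, and strictly separating for $\mathcal{D}$ if in addition $x'\in U'_{++}$. $(U,\tau)$ has the Kreps-Yan property if for every $\tau$-closed convex cone $\mathcal{D}\subset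 U$ with $-U_+\subset\mathcal{D}$ and $\mathcal{D}\cap U_+=\{0\}$ there exists a strictly separating functional $x'\in U'_{++}$ for $\mathcal{D}$. *)

(* Defs.v *)
From HB Require Import structures.
From mathcomp Require Import all_boot all_order all_algebra.
From mathcomp Require Import all_classical all_reals all_analysis.

Set Implicit Arguments.
Unset Strict Implicit.
Unset Printing Implicit Defensive.

Import Order.TTheory GRing.Theory Num.Theory.
Import numFieldNormedType.Exports.

Local Open Scope classical_set_scope.
Local Open Scope ring_scope.

(* The join of Order.Lattice with the Lmodule hierarchy is not available: HB
   requires it to be declared before Num.RealDomain.  The lattice operations
   are therefore part of this mixin; the order determines them. *)
HB.mixin Record POrderedLmodule_isVectorLattice (R : realType) V
    of Num.POrderedZmodule V & GRing.Lmodule R V := {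
  joinv : V -> V -> V ;
  meetv : V -> V -> V ;
  leUv : forall x y z : V, (joinv x y <= z) = (x <= z) && (y <= z) ;
  levI : forall x y z : V, (z <= meetv x y) = (z <= x) && (z <= y) ;
  lev_wD2r : forall z x y : V, x <= y -> x + z <= y + z ;
  scalev_ge0 : forall (a : R) (x : V), 0 <= a -> 0 <= x -> 0 <= a *: x
}.

#[short(type="vectorLatticeType")]
HB.structure Definition VectorLattice (R : realType) :=
  { V of Num.POrderedZmodule V & GRing.Lmodule R V
       & POrderedLmodule_isVectorLattice R V }.

Section VectorLatticeDefs.
Context (R : realType) (V : vectorLatticeType R).
Implicit Types (x y : V) (A K I : set V).

Definition vabs x : V := joinv x (- x).

Definition solid A := forall x y, A x -> vabs y <= vabs x -> A y.

Definition linear_subspace A :=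
  A 0 /\ forall (a b : R) x y, A x -> A y -> A (a *: x + b *: y).

Definition ideal I := solid I /\ linear_subspace I.

Definition pos_cone : set V := [set x | 0 <= x].

Definition convex_cone K :=
  K !=set0 /\ forall (a b : R) x y,
    0 <= a -> 0 <= b -> K x -> K y -> K (a *: x + b *: y).

End VectorLatticeDefs.

Arguments pos_cone {R} V.

HB.mixin Record TopologicalLmodule_isTopologicalVectorLattice (R : realType) V
    of VectorLattice R V & TopologicalLmodule R V := {
  tvl_hausdorff : hausdorff_space V ;
  nbhs0_solid : forall A : set V, nbhs 0 A ->
    exists B : set V, [/\ nbhs 0 B, solid B & B `<=` A]
}.

#[short(type="topVectorLatticeType")]
HB.structure Definition TopologicalVectorLattice (R : realType) :=
  { V of VectorLattice R V & TopologicalLmodule R V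
       & TopologicalLmodule_isTopologicalVectorLattice R V }.

(* The library's Tvs is locally convex.  It also carries a uniform structure
   inducing the topology; every locally convex vector topology has one (see
   the factory PreTopologicalLmod_isTvs), and nothing below refers to it. *)
#[short(type="lcTopVectorLatticeType")]
HB.structure Definition LCTopologicalVectorLattice (R : realType) :=
  { U of TopologicalVectorLattice R U & Tvs R U }.

(* A subset I of V, seen as a type with the vector space structure and the
   order induced by V, together with a locally convex vector lattice topology
   of its own, unrelated to the topology of V. *)
#[short(type="lcTopVectorSublatticeType")]
HB.structure Definition LCTopologicalVectorSublattice (R : realType)
    (V : vectorLatticeType R) (I : set V) :=
  { U of LCTopologicalVectorLattice R U
       & @GRing.SubLmodule R V [in I] U
       & @Order.SubPOrder ring_display V [in I] ring_display U }.

Section Duality.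
Context (R : realType) (U : topVectorLatticeType R).
Implicit Types (D : set U) (f : {linear U -> R^o}).

Definition top_dual : set {linear U -> R^o} := [set f | continuous f].

Definition pos_dual : set {linear U -> R^o} :=
  top_dual `&` [set f | forall x : U, pos_cone U x -> 0 <= f x :> R].

Definition spos_dual : set {linear U -> R^o} :=
  pos_dual `&`
  [set f | forall x : U, (pos_cone U `\ 0) x -> 0 < f x :> R].

Definition separating D f :=
  pos_dual f /\ forall y : U, D y -> f y <= 0 :> R.

Definition strictly_separating D f := separating D f /\ spos_dual f.

Definition Kreps_Yan :=
  forall D, closed D -> convex_cone D ->
    [set - x | x in pos_cone U] `<=` D ->
    D `&` pos_cone U = [set 0] ->
    exists f, strictly_separating D f.

End Duality.

Arguments Kreps_Yan {R} U.

Section NoFreeLunch.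
Context (R : realType) (V : topVectorLatticeType R) (I : set V).
Context (U : lcTopVectorSublatticeType I) (K0 : set V).

(* The set (K0 - V_+) `&` I, as a subset of the subtype U. *)
Definition superreplicable : set U :=
  \val @^-1` [set k - p | k in K0 & p in pos_cone V].

Definition NFL := closure superreplicable `&` pos_cone U = [set 0].

End NoFreeLunch.

Arguments superreplicable {R V I} U K0.
Arguments NFL {R V I} U K0.

(* Main.v *)
(* The closure of the superreplicable set C is a closed convex cone containing
   -U_+, so NFL is exactly what the Kreps-Yan property needs to separate it.
   Conversely, a continuous f <= 0 on C stays <= 0 on the closure of C, where a
   nonzero positive x would give f x > 0. *)

Require Import Defs.
From mathcomp Require Import all_boot all_order all_algebra.
From mathcomp Require Import all_classical all_reals all_analysis.

Local Open Scope classical_set_scope.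

Import Order.TTheory GRing.Theory Num.Theory.
Import numFieldNormedType.Exports.
Local Open Scope ring_scope.

Lemma convex_cone0 (R : realType) (V : vectorLatticeType R) (K : set V) :
  convex_cone K -> K 0.
Proof.
by move=> [[x Kx] coneK]; have := coneK 0 0 x x; rewrite !scale0r addr0; apply.
Qed.

(** Joint continuity of addition, then continuity of each scaling, pull a neighborhood of
    [a *: x + b *: y] back to neighborhoods of [x] and [y], each of which meets [K]. *)
Lemma convex_cone_closure (R : realType) (U : topVectorLatticeType R)
  (K : set U) : convex_cone K -> convex_cone (closure K).
Proof.
move=> [[z Kz] coneK]; split; first by exists z; exact: subset_closure.
move=> a b x y a0 b0 clKx clKy W nbhsW.
have scaleW (c : R) (u : U) : (fun v : U => c *: v) @ u --> c *: u.
  exact: (cvg_comp2 (cvg_cst _) cvg_id (@scale_continuous R U (c, u))).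
have [[A B] /= [nbhsA nbhsB] ABW] :=
  @add_continuous U (a *: x, b *: y) W nbhsW.
have [u [Ku Au]] := clKx _ (scaleW a x A nbhsA).
have [v [Kv Bv]] := clKy _ (scaleW b y B nbhsB).
by exists (a *: u + b *: v); split; [exact: coneK | exact: (ABW (_, _))].
Qed.

(** The preimage of the closed half-line of nonpositive reals under the continuous [f] is closed and
    contains [D]. *)
Lemma separating_closure (R : realType) (U : topVectorLatticeType R)
  (D : set U) (f : {linear U -> R^o}) :
  separating D f -> separating (closure D) f.
Proof.
move=> [[f_cont f_ge0] f_le0]; split=> // y clDy.
have : closed (f @^-1` [set r : R^o | r <= 0]).
  by apply: closed_comp => [x _|]; [exact: f_cont | exact: closed_le].
by apply; exact: closure_subset clDy.
Qed.

Lemma separatingS (R : realType) (U : topVectorLatticeType R)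
  (D E : set U) (f : {linear U -> R^o}) :
  D `<=` E -> separating E f -> separating D f.
Proof. by move=> DE [posf f_le0]; split=> // y /DE; exact: f_le0. Qed.

Lemma superreplicableN (R : realType) (V : topVectorLatticeType R)
  (I : set V) (U : lcTopVectorSublatticeType I) (K0 : set V) (x : U) :
  convex_cone K0 -> 0 <= x -> superreplicable U K0 (- x).
Proof.
(* Write [- x] as [0 - x] with [0] in [K0]; [x] stays positive in [V] because the order of [U] is
   induced. *)
move=> coneK0 x0; exists 0; first exact: convex_cone0.
exists (\val x); last by rewrite sub0r raddfN.
by rewrite /pos_cone /= -(raddf0 (\val : U -> V)) Order.le_val.
Qed.

Lemma convex_cone_superreplicable (R : realType) (V : topVectorLatticeType R)
  (I : set V) (U : lcTopVectorSublatticeType I) (K0 : set V) :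
  convex_cone K0 -> convex_cone (superreplicable U K0).
Proof.
move=> coneK0; split; first by exists (- 0); exact: superreplicableN.
move=> a b x y a0 b0 [k Kk [p p0 kpx]] [l Kl [q q0 lqy]].
exists (a *: k + b *: l); first by case: coneK0 => _; apply.
(* Combining [k - p] and [l - q] combines the [K0] parts and the positive parts separately. *)
exists (a *: p + b *: q).
  have ap0 : 0 <= a *: p by exact: scalev_ge0.
  have bq0 : 0 <= b *: q by exact: scalev_ge0.
  (* Translating [0 <= a *: p] by [b *: q] gives [b *: q <= a *: p + b *: q]. *)
  apply: (le_trans bq0); rewrite -[leLHS]add0r.
  exact: lev_wD2r.
have valDZ : \val (a *: x + b *: y) = a *: (\val x : V) + b *: (\val y : V).
  rewrite (raddfD (\val : U -> V)).
  by congr (_ + _); exact: (linearZ_LR (\val : U -> V)).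
by rewrite valDZ -kpx -lqy !scalerBr opprD addrACA.
Qed.

Theorem theorem4p10 (R : realType) (V : topVectorLatticeType R)
  (K0 : set V) (hK0 : convex_cone K0)
  (I : set V) (idealI : ideal I) (denseI : dense I)
  (U : lcTopVectorSublatticeType I) (hKY : Kreps_Yan U) :
  NFL U K0 <->
  exists f : {linear U -> R^o}, strictly_separating (superreplicable U K0) f.
Proof.
have coneC := convex_cone_superreplicable R V I U K0 hK0.
split=> [nfl | [f [sepf [_ f_gt0]]]].
  have [||||f [sepf sposf]] := hKY (closure (superreplicable U K0)).
  - exact: closed_closure.
  - exact: convex_cone_closure.
  - move=> _ [x x0 <-]; apply: subset_closure.
    exact: superreplicableN.
  - exact: nfl.
  (* Strict positivity of [f] does not depend on the separated set, so only the sign condition has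
     to be restricted. *)
  by exists f; split=> //; apply: separatingS sepf; exact: subset_closure.
apply/seteqP; split=> [x [clCx x0]|_ ->].
  apply: contrapT => xN0; have := f_gt0 x (conj x0 xN0).
  have [_ /(_ _ clCx)] := separating_closure _ _ _ _ sepf.
  by rewrite leNgt => /negP.
split; last exact: lexx.
(* The inclusion of [0] holds for any [K0] that is a cone; the content of NFL is the other
   inclusion. *)
by apply: subset_closure; exact: convex_cone0.
Qed.
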